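(* For every $\varepsilon>0$ there exists $c=c(\varepsilon)$ such that the following holds. For each graph $G$ and each probability $p\in(0,1]$ with $e(G)\,p\ge c$, the random graph $G_p$ satisfies $q^*(G_p)>q^*(G)-\varepsilon$ with probability at least $1-\varepsilon$.
   Context: Graphs are finite and simple; $e(G)$ is the number of edges of $G$. For a graph $G$ with $m\ge 1$ edges and a vertex partition $\mathcal{A}$ of $V(G)$, the modularity score is $q_{\mathcal{A}}(G)=\frac1m\sum_{A\in\mathcal{A}}e(A)-\frac1{4m^2}\sum_{A\in\mathcal{A}}\mathrm{vol}(A)^2$, where $e(A)$ is the number of edges of $G$ with both ends in $A$ and $\mathrm{vol}(A)$ is the sum of the degrees (in $G$) of the vertices in $A$. If $G$ has no edges then $q_{\mathcal{A}}(G)=0$ for every $\mathcal{A}$. The modularity of $G$ is $q^*(G)=\max_{\mathcal{A}}q_{\mathcal{A}}(G)$, the maximum over all vertex partitions. For $0<p\le 1$, $G_p$ is the random subgraph of $G$ on the same vertex set obtained by keeping each edge of $G$ independently with probability $p$ (and otherwise deleting it). *)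

(* Defs.v *)
From HB Require Import structures.
From mathcomp Require Import all_boot all_order all_algebra.
From mathcomp Require Import reals.

Set Implicit Arguments.
Unset Strict Implicit.
Unset Printing Implicit Defensive.

Import Order.TTheory GRing.Theory Num.Theory.
Local Open Scope ring_scope.

(* A finite simple graph on the vertex set T: an edge is a two-element set. *)
Record sgraph (T : finType) := SGraph {
  edges : {set {set T}};
  edges_card2 : [forall e in edges, #|e| == 2%N] }.

HB.instance Definition _ (T : finType) := [isSub for @edges T].
HB.instance Definition _ (T : finType) := [Finite of sgraph T by <:].

Section Modularity.
Variables (R : realType) (T : finType).
Implicit Types (G H : sgraph T) (A : {set T}) (P : {set {set T}}).

Definition nedges G : nat := #|edges G|.

Definition edges_within G A : nat := #|[set e in edges G | e \subset A]|.

Definition degree G (v : T) : nat := #|[set e in edges G | v \in e]|.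

Definition vol G A : nat := (\sum_(v in A) degree G v)%N.

Definition modularity_score G P : R :=
  if nedges G == 0%N then 0 else
  (nedges G)%:R^-1 * (\sum_(A in P) (edges_within G A)%:R)
  - (4 * (nedges G)%:R ^+ 2)^-1 * (\sum_(A in P) (vol G A)%:R ^+ 2).

Definition singletons : {set {set T}} := [set [set x] | x in T].

(* The default value of the maximum is the score of a genuine partition, so
   this is the maximum over partitions; see modularity_ge and
   modularity_attained. *)
Definition modularity G : R :=
  \big[Num.max/modularity_score G singletons]_(P | partition P [set: T])
     modularity_score G P.

(* The law of G_p: the probability that the retained edges are exactly those
   of H, each edge of G being kept independently with probability p. *)
Definition percolation (p : R) G H : R :=
  if edges H \subset edges G
  then \prod_(e in edges G) (if e \in edges H then p else 1 - p)
  else 0.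

Definition percolation_prob (p : R) G (Q : pred (sgraph T)) : R :=
  \sum_(H | Q H) percolation p G H.

Lemma singletons_partition : partition singletons [set: T].
Proof.
have -> : singletons = preim_partition id [set: T].
  apply/setP => A; apply/imsetP/imsetP => -[x _ ->]; exists x; rewrite ?inE //;
  by apply/setP => y; rewrite !inE // eq_sym.
exact: preim_partitionP.
Qed.

Lemma modularity_ge G P :
  partition P [set: T] -> modularity_score G P <= modularity G.
Proof. by move=> hP; rewrite /modularity (bigD1 P) //= le_max lexx. Qed.

Lemma modularity_attained G :
  exists2 P, partition P [set: T] & modularity G = modularity_score G P.
Proof.
rewrite /modularity.
elim/big_ind: _ => [|x y [P hP ->] [P' hP' ->]|P hP].
- by exists singletons => //; exact: singletons_partition.
- by case: leP => _; [exists P' | exists P].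
- by exists P.
Qed.

(* Each edge is kept with probability p, independently; S = set0 gives total
   mass 1. *)
Lemma percolation_keep (p : R) G (S : {set {set T}}) :
  S \subset edges G ->
  percolation_prob p G (fun H => S \subset edges H) = p ^+ #|S|.
Proof.
move=> sSG; set E := edges G.
have card2 (F : {set {set T}}) : F \subset E -> [forall e in F, #|e| == 2%N].
  move=> /subsetP sFE; apply/forall_inP => e /sFE.
  exact: (forall_inP (edges_card2 G)).
pose a e : R := if e \in E then p else 0.
pose b e : R := if e \in E then (if e \in S then 0 else 1 - p) else 1.
have -> : p ^+ #|S| = \prod_e (a e + b e).
  rewrite -prodr_const big_mkcond; apply: eq_bigr => e _; rewrite /a /b.
  case: ifPn => [/(subsetP sSG) ->|_]; first by rewrite addr0.
  by case: ifP; rewrite ?add0r // addrC subrK.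
rewrite bigA_distr /percolation_prob.
rewrite (bigID (fun F : {set {set T}} => (F \subset E) && (S \subset F))) /=.
rewrite [X in _ = _ + X]big1 ?addr0; last first.
  move=> F /nandP[/subsetPn[e eF eE]|/subsetPn[e eS eF]].
    by rewrite (bigD1 e) //= eF /a (negPf eE) mul0r.
  by rewrite (bigD1 e) //= (negPf eF) /b (subsetP sSG e eS) eS mul0r.
rewrite (bigID (fun H => edges H \subset E)) /=.
rewrite [X in _ + X]big1 ?addr0 => [|H /andP[_ /negPf nH]]; last first.
  by rewrite /percolation -/E nH.
rewrite [RHS](reindex_onto (@edges T) (insubd G)) => [|F /andP[sFE _]]; last first.
  by rewrite -[edges _]/(val _) insubdK //; exact: card2.
apply: eq_big => [H|H /andP[sSH sHE]].
  by rewrite -[edges H]/(val H) valKd eqxx andbT andbC.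
rewrite /percolation -/E sHE big_mkcond; apply: eq_bigr => e _; rewrite /a /b.
case: ifP => eE; case: ifP => eH //.
  by case: ifP => // /(subsetP sSH); rewrite eH.
by move: (subsetP sHE e eH); rewrite eE.
Qed.

End Modularity.

(* Main.v *)
Require Import Defs.
From mathcomp Require Import all_boot all_order all_algebra.
From mathcomp Require Import reals.
From mathcomp Require Import ring lra.

(** The argument is a second moment bound for one fixed partition: take P
    optimal for G and show that its score on G_p falls little below its score
    on G; the modularity of G_p is at least that score.

    Write m = e(G), mu = p m, and let M be the number of edges of G_p, I the
    number of those inside parts and vol_p(A) the volume of A in G_p. All of
    these are weighted edge counts, i.e. linear in the independent indicators
    of the retained edges, so each has mean p times its value on G and variance
    p (1 - p) times the sum of the squared weights
    ([edge_weight_variance]). An edge weighs 1 in M, at most 1 in I, and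
    #|e :&: A| in vol_p(A); since the parts are disjoint the last weights have
    squares summing to at most 4 over all parts. Hence the squared Euclidean
    distance between the whole vector (M, I, (vol_p(A))_A) and its mean has
    expectation at most 6 mu, however many parts there are
    ([deviation_mean]). A single application of Markov's inequality
    ([percolation_markov]) makes this distance at most eta mu with probability
    at least 1 - eps, as soon as 6 mu <= eps (eta mu)^2.

    The rest is deterministic ([score_perturbation]). The scalars M and I are
    within eta mu of their means. The degree tax only needs an upper bound, and
    the sum of squares of vol_p(A) is a squared Euclidean norm, so that closeness
    of the vectors is enough: Young's inequality [young_sqr] bounds it by
    1 + eta times its value at the mean plus an error of order eta mu^2.
    Altogether the score drops by at most 9 eta, and eta <= eps / 10. *)

Set Implicit Arguments.
Unset Strict Implicit.

Import Order.TTheory GRing.Theory Num.Theory.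
Local Open Scope ring_scope.

(** * Weighted edge counts under percolation *)

Definition percolation_mean {R : realType} {T : finType} (p : R)
    (G : sgraph T) (f : sgraph T -> R) : R :=
  \sum_H percolation p G H * f H.

Definition edge_weight {R : realType} {T : finType} (w : {set T} -> R)
    (G : sgraph T) : R :=
  \sum_(e in edges G) w e.

Section Percolation.
Variables (R : realType) (T : finType) (p : R) (G : sgraph T).
Hypotheses (p_ge0 : 0 <= p) (p_le1 : p <= 1).
Implicit Types (H : sgraph T) (e f : {set T}) (w : {set T} -> R).

Lemma percolation_ge0 H : 0 <= percolation p G H.
Proof.
rewrite /percolation; case: ifP => // _; apply: prodr_ge0 => e _.
by case: ifP => // _; rewrite subr_ge0.
Qed.

Lemma percolation_mean_keep (S : {set {set T}}) :
  S \subset edges G ->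
  percolation_mean p G (fun H => (S \subset edges H)%:R) = p ^+ #|S|.
Proof.
move=> /(percolation_keep p) <-; rewrite /percolation_prob big_mkcond /=.
by apply: eq_bigr => H _; case: ifP => _; rewrite ?mulr1 ?mulr0.
Qed.

Lemma percolation_mass : \sum_H percolation p G H = 1.
Proof.
rewrite -[RHS](expr0 p) -(cards0 {set T}) -(percolation_mean_keep (S := set0)) ?sub0set //.
by apply: eq_bigr => H _; rewrite sub0set mulr1.
Qed.

(** Expanding the product leaves the probabilities of keeping {e}, {f} and
    {e, f}; the last set has one or two elements, which makes all the
    difference between p and p ^+ 2. *)
Lemma percolation_cov e f : e \in edges G -> f \in edges G ->
  percolation_mean p G
    (fun H => ((e \in edges H)%:R - p) * ((f \in edges H)%:R - p))
  = if e == f then p * (1 - p) else 0.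
Proof.
move=> eG fG.
have E1 g : g \in edges G ->
    \sum_H percolation p G H * (g \in edges H)%:R = p.
  move=> gG; rewrite -[RHS]expr1 -(cards1 g) -percolation_mean_keep ?sub1set //.
  by apply: eq_bigr => H _; rewrite sub1set.
have E2 : \sum_H percolation p G H * ((e \in edges H)%:R * (f \in edges H)%:R)
    = p ^+ #|[set e; f]|.
  rewrite -percolation_mean_keep; last by rewrite subUset !sub1set eG fG.
  by apply: eq_bigr => H _; rewrite subUset !sub1set -natrM mulnb.
transitivity (
    \sum_H percolation p G H * ((e \in edges H)%:R * (f \in edges H)%:R)
    - p * (\sum_H percolation p G H * (f \in edges H)%:R)
    - p * (\sum_H percolation p G H * (e \in edges H)%:R)
    + p * p * \sum_H percolation p G H).
  rewrite !mulr_sumr -!sumrB -big_split /=.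
  by apply: eq_bigr => H _; ring.
rewrite E2 !E1 // percolation_mass.
rewrite cards2; case: eqP => _ /=; ring.
Qed.

(** The off-diagonal terms of the expanded square vanish by independence. *)
Lemma percolation_variance w :
  percolation_mean p G
    (fun H => (\sum_(e in edges G) w e * ((e \in edges H)%:R - p)) ^+ 2)
  = p * (1 - p) * edge_weight (fun e => w e ^+ 2) G.
Proof.
transitivity (\sum_(e in edges G) \sum_(f in edges G)
    w e * w f * (if e == f then p * (1 - p) else 0)).
  rewrite /percolation_mean.
  transitivity (\sum_H \sum_(e in edges G) \sum_(f in edges G) w e * w f *
     (percolation p G H *
      (((e \in edges H)%:R - p) * ((f \in edges H)%:R - p)))).
    apply: eq_bigr => H _; rewrite expr2 big_distrlr /= mulr_sumr.
    apply: eq_bigr => e _; rewrite mulr_sumr.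
    by apply: eq_bigr => f _; ring.
  rewrite exchange_big /=; apply: eq_bigr => e eG.
  rewrite exchange_big /=; apply: eq_bigr => f fG.
  by rewrite -mulr_sumr -percolation_cov.
rewrite /edge_weight mulr_sumr; apply: eq_bigr => e eG.
rewrite (bigD1 e) //= eqxx big1 ?addr0; first by ring.
by move=> f /andP[_ /negPf]; rewrite eq_sym => ->; rewrite mulr0.
Qed.

Lemma edge_weight_deviation w H : edges H \subset edges G ->
  edge_weight w H - p * edge_weight w G
  = \sum_(e in edges G) w e * ((e \in edges H)%:R - p).
Proof.
move=> sHG.
have -> : edge_weight w H = \sum_(e in edges G) w e * (e \in edges H)%:R.
  rewrite (big_setID (edges H)) /= (setIidPr sHG).
  rewrite [X in _ = _ + X]big1 ?addr0 => [|e /setDP[_ /negPf ->]]; last first.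
    by rewrite mulr0.
  by apply: eq_bigr => e ->; rewrite mulr1.
rewrite /edge_weight mulr_sumr -sumrB; apply: eq_bigr => e _; ring.
Qed.

(** The deviation identity holds only for subgraphs of G, but other graphs have
    probability zero. *)
Lemma edge_weight_variance w :
  percolation_mean p G
    (fun H => (edge_weight w H - p * edge_weight w G) ^+ 2)
  = p * (1 - p) * edge_weight (fun e => w e ^+ 2) G.
Proof.
rewrite -percolation_variance; apply: eq_bigr => H _.
have [sHG|nHG] := boolP (edges H \subset edges G).
  by rewrite edge_weight_deviation.
by rewrite /percolation (negPf nHG) !mul0r.
Qed.

(** Markov's inequality: outside Q the nonnegative D exceeds t. *)
Lemma percolation_markov (D : sgraph T -> R) (a t : R) (Q : pred (sgraph T)) :
  0 < t -> (forall H, 0 <= D H) -> percolation_mean p G D <= a * t ->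
  (forall H, D H <= t -> Q H) ->
  1 - a <= percolation_prob p G Q.
Proof.
move=> t0 D0 Da DQ; rewrite -percolation_mass (bigID Q) /= lerBlDr lerD2l.
rewrite -(ler_pM2r t0); apply: le_trans Da.
rewrite mulr_suml /percolation_mean [leRHS](bigID Q) /= -[leLHS]add0r.
apply: lerD.
  by apply: sumr_ge0 => H _; rewrite mulr_ge0 ?percolation_ge0.
apply: ler_sum => H nQ; rewrite ler_wpM2l ?percolation_ge0 //.
by apply: contraNT nQ; rewrite -ltNge => /ltW; exact: DQ.
Qed.

End Percolation.

(** * The edge counts attached to a partition *)

Lemma edge_card {T : finType} (G : sgraph T) (e : {set T}) :
  e \in edges G -> #|e| = 2%N.
Proof. by move=> eG; apply/eqP; exact: (forall_inP (edges_card2 G)). Qed.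

Section Partition.
Variables (R : realType) (T : finType) (P : {set {set T}}).
Hypothesis Ppart : partition P [set: T].
Implicit Types (G H : sgraph T) (e A : {set T}).

Definition inner_weight e : R := \sum_(A in P) (e \subset A)%:R.

Definition incidence A e : R := #|e :&: A|%:R.

Lemma nedgesE G : (nedges G)%:R = edge_weight (fun=> 1 : R) G.
Proof. by rewrite /edge_weight /nedges sumr_const. Qed.

Lemma edges_withinE G :
  \sum_(A in P) (edges_within G A)%:R = edge_weight inner_weight G.
Proof.
rewrite /edge_weight exchange_big /=; apply: eq_bigr => A _.
rewrite /edges_within -sum1_card natr_sum big_mkcond /= [RHS]big_mkcond /=.
by apply: eq_bigr => e _; rewrite inE; case: (e \in edges G); case: (e \subset A).
Qed.

Lemma volE G A : (vol G A)%:R = edge_weight (incidence A) G.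
Proof.
rewrite /vol /edge_weight natr_sum.
under eq_bigr => v _ do rewrite /degree -sum1_card natr_sum.
rewrite (exchange_big_dep (mem (edges G))) /=; last first.
  by move=> v e _; rewrite inE => /andP[].
apply: eq_bigr => e eG; rewrite /incidence -sum1_card natr_sum.
by apply: eq_bigl => v; rewrite !inE eG andbC.
Qed.

Lemma sum_incidence e : \sum_(A in P) incidence A e = #|e|%:R.
Proof.
transitivity (\sum_(A in P) \sum_(v in A) ((v \in e)%:R : R)).
  apply: eq_bigr => A _; rewrite /incidence -sum1_card natr_sum.
  rewrite big_mkcond [RHS]big_mkcond /=; apply: eq_bigr => v _.
  by rewrite inE; case: (v \in e); case: (v \in A).
rewrite -big_trivIset; last by case/and3P: Ppart.
rewrite (cover_partition Ppart) -sum1_card natr_sum [RHS]big_mkcond /=.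
by apply: eq_big => v; rewrite ?inE //; case: ifP.
Qed.

(** This is why the number of parts does not matter: each incidence is at
    most #|e|, and the incidences sum to #|e|. *)
Lemma sum_incidence_sqr e : \sum_(A in P) incidence A e ^+ 2 <= #|e|%:R ^+ 2.
Proof.
rewrite [leRHS]expr2 -{2}sum_incidence mulr_sumr; apply: ler_sum => A _.
by rewrite expr2 ler_wpM2r // ler_nat subset_leq_card // subsetIl.
Qed.

(** A part that contains e has incidence 2 with it, and the incidences of an
    edge sum to 2, so at most one part contains it. *)
Lemma inner_weight_itv G e : e \in edges G -> 0 <= inner_weight e <= 1.
Proof.
move=> eG; rewrite sumr_ge0 //=.
have : 2 * inner_weight e <= 2.
  rewrite -[leRHS]/(2%:R : R) -(edge_card eG) -[leRHS]sum_incidence (edge_card eG).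
  rewrite mulr_sumr; apply: ler_sum => A _; rewrite /incidence.
  case: (boolP (e \subset A)) => [/setIidPl|_]; last by rewrite mulr0.
  by rewrite setIC => ->; rewrite (edge_card eG) mulr1.
by rewrite -[leRHS]mulr1 ler_pM2l.
Qed.

Lemma inner_edge_weight_itv G :
  0 <= edge_weight inner_weight G <= (nedges G)%:R.
Proof.
rewrite nedgesE; apply/andP; split.
  by apply: sumr_ge0 => e /inner_weight_itv/andP[].
by apply: ler_sum => e /inner_weight_itv/andP[].
Qed.

Lemma sum_vol G : \sum_(A in P) (vol G A)%:R = 2 * (nedges G)%:R :> R.
Proof.
under eq_bigr => A _ do rewrite volE.
rewrite exchange_big nedgesE mulr_sumr /=; apply: eq_bigr => e eG.
by rewrite sum_incidence (edge_card eG) mulr1.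
Qed.

(** Each volume is at most the total volume, which is twice the number of
    edges. This is what keeps the degree tax at most 1. *)
Lemma sum_vol_sqr_le G :
  \sum_(A in P) (vol G A)%:R ^+ 2 <= 4 * (nedges G)%:R ^+ 2 :> R.
Proof.
have -> : 4 * (nedges G)%:R ^+ 2 = (2 * (nedges G)%:R) ^+ 2 :> R by ring.
rewrite expr2 -{2}sum_vol mulr_sumr; apply: ler_sum => A AP.
by rewrite expr2 ler_wpM2r // -sum_vol (bigD1 A) //= lerDl sumr_ge0.
Qed.

Definition deviation (p : R) G H : R :=
  ((nedges H)%:R - p * (nedges G)%:R) ^+ 2
  + (edge_weight inner_weight H - p * edge_weight inner_weight G) ^+ 2
  + \sum_(A in P) ((vol H A)%:R - p * (vol G A)%:R) ^+ 2.

Lemma deviation_ge0 (p : R) G H : 0 <= deviation p G H.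
Proof. by rewrite !addr_ge0 ?sqr_ge0 ?sumr_ge0 // => A _; rewrite sqr_ge0. Qed.

(** Each edge contributes at most 1 + 1 + 4 to the sum of squared weights: once
    for the edge count, once for the inner edges, and 4 for the volumes. *)
Lemma deviation_mean (p : R) G : 0 <= p -> p <= 1 ->
  percolation_mean p G (deviation p G) <= 6 * ((nedges G)%:R * p).
Proof.
move=> p0 p1.
have -> : percolation_mean p G (deviation p G) = p * (1 - p) *
    (edge_weight (fun=> 1 ^+ 2) G + edge_weight (fun e => inner_weight e ^+ 2) G
     + \sum_(A in P) edge_weight (fun e => incidence A e ^+ 2) G).
  rewrite 2!mulrDr [X in _ + X]mulr_sumr -(edge_weight_variance p G (fun=> 1)).
  rewrite -(edge_weight_variance p G inner_weight).
  under [X in _ = _ + X]eq_bigr => A _ do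
    rewrite -(edge_weight_variance p G (incidence A)).
  rewrite /percolation_mean exchange_big /= -!big_split /=.
  apply: eq_bigr => H _; rewrite /deviation !mulrDr !nedgesE.
  by congr (_ + _); rewrite mulr_sumr; apply: eq_bigr => A _; rewrite !volE.
set s := (X in _ * X).
have s_ge0 : 0 <= s.
  have w_ge0 (w : {set T} -> R) : 0 <= edge_weight (fun e => w e ^+ 2) G.
    by apply: sumr_ge0 => e _; exact: sqr_ge0.
  apply: addr_ge0; last by apply: sumr_ge0 => A _; exact: w_ge0.
  by apply: addr_ge0; [exact: (w_ge0 (fun=> 1)) | exact: w_ge0].
have s_le : s <= 6 * (nedges G)%:R.
  rewrite /s [X in _ + X]exchange_big /= -!big_split /= nedgesE mulr_sumr.
  apply: ler_sum => e eG; have /andP[i0 i1] := inner_weight_itv eG.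
  have := sum_incidence_sqr e; rewrite (edge_card eG).
  have : inner_weight e ^+ 2 <= 1 by rewrite expr_le1.
  by move=> ? ?; lra.
apply: (@le_trans _ _ (p * s)).
  by rewrite ler_wpM2r // ler_piMr //; lra.
by rewrite [_ * p]mulrC mulrCA ler_wpM2l.
Qed.

End Partition.

(** * Stability of the score *)

(** For volumes with b near a, this replaces the triangle inequality for the
    Euclidean norm: it sums over the parts without any square root. *)
Lemma young_sqr {R : realType} (eta a b : R) : 0 < eta ->
  b ^+ 2 <= (1 + eta) * a ^+ 2 + (1 + eta^-1) * (b - a) ^+ 2.
Proof.
move=> h0; rewrite -subr_ge0.
have -> : (1 + eta) * a ^+ 2 + (1 + eta^-1) * (b - a) ^+ 2 - b ^+ 2
   = eta^-1 * (eta * a - (b - a)) ^+ 2 by field; rewrite gt_eqF.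
by rewrite mulr_ge0 ?sqr_ge0 // invr_ge0 ltW.
Qed.

(** The arithmetic of the score: x and t are the fraction of inner edges and the
    degree tax on G, while M, I and V are the edge count, inner edge count and
    sum of squared volumes on the subgraph. The first ratio loses at most
    2 eta and the second gains at most 7 eta. *)
Lemma ratio_perturbation {R : realType} (eta mu M I V x t : R) :
  0 < eta -> eta <= 1 / 4 -> 0 < mu ->
  0 <= x <= 1 -> 0 <= t <= 1 ->
  (1 - eta) * mu <= M -> M <= (1 + eta) * mu -> (x - eta) * mu <= I ->
  V <= ((1 + eta) * (4 * t) + (eta + eta ^+ 2)) * mu ^+ 2 ->
  x - t - 9 * eta <= M^-1 * I - (4 * M ^+ 2)^-1 * V.
Proof.
move=> h0 h4 mu0 /andP[x0 x1] /andP[t0 t1] Ml Mu Il Vu.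
have M0 : 0 < M by apply: lt_le_trans Ml; rewrite mulr_gt0 //; lra.
have coverage : x - 2 * eta <= M^-1 * I.
  rewrite [leRHS]mulrC ler_pdivlMr //; apply: le_trans Il.
  (* The sign decides which of the two bounds on M is the unfavourable one. *)
  have [xh|xh] := leP 0 (x - 2 * eta).
    apply: le_trans (ler_wpM2l xh Mu) _.
    by rewrite mulrA ler_wpM2r ?ltW //; nra.
  have xh' : x - 2 * eta <= 0 by exact: ltW.
  apply: le_trans (ler_wnM2l xh' Ml) _.
  by rewrite mulrA ler_wpM2r ?ltW //; nra.
have tax : (4 * M ^+ 2)^-1 * V <= t + 7 * eta.
  have M20 : 0 < 4 * M ^+ 2 by rewrite mulr_gt0 // exprn_gt0.
  rewrite [leLHS]mulrC ler_pdivrMr //; apply: le_trans Vu _.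
  have M2 : ((1 - eta) * mu) ^+ 2 <= M ^+ 2.
    have N0 : 0 <= (1 - eta) * mu by rewrite mulr_ge0 ?(ltW mu0) //; lra.
    by rewrite ler_sqr // nnegrE ltW.
  have th : 0 <= (t + 7 * eta) * 4 by lra.
  rewrite [leRHS]mulrA; apply: le_trans (ler_wpM2l th M2).
  rewrite exprMn [leRHS]mulrA ler_wpM2r ?sqr_ge0 //.
  have -> : (t + 7 * eta) * 4 * (1 - eta) ^+ 2 =
    (t + 7 * eta) * 4 * (1 - 2 * eta) + (t + 7 * eta) * 4 * eta ^+ 2 by ring.
  have : 0 <= (t + 7 * eta) * 4 * eta ^+ 2 by rewrite mulr_ge0 ?sqr_ge0.
  by nra.
by lra.
Qed.

(** Young's inequality is used with the parameter eta itself: the error term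
    (1 + 1 / eta) (eta mu)^2 is then (eta + eta^2) mu^2, of the same order as
    the multiplicative loss 1 + eta. *)
Lemma score_perturbation {R : realType} {T : finType} (P : {set {set T}})
    (G H : sgraph T) (p eta : R) :
  partition P [set: T] -> 0 < eta -> eta <= 1 / 4 ->
  0 < (nedges G)%:R * p ->
  deviation P p G H <= (eta * ((nedges G)%:R * p)) ^+ 2 ->
  modularity_score R G P - 9 * eta <= modularity_score R H P.
Proof.
move=> PP h0 h4.
set m : R := (nedges G)%:R; set mu := m * p => mu0 Ddev.
have m0 : 0 < m.
  rewrite lt_def ler0n andbT; apply/eqP => mz.
  by move: mu0; rewrite /mu mz mul0r ltxx.
set M : R := (nedges H)%:R.
set i := edge_weight (inner_weight R P) G.
set I := edge_weight (inner_weight R P) H.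
set S := \sum_(A in P) ((vol H A)%:R - p * (vol G A)%:R) ^+ 2.
have S0 : 0 <= S by apply: sumr_ge0 => A _; exact: sqr_ge0.
have {Ddev} Ddev : (M - mu) ^+ 2 + (I - p * i) ^+ 2 + S <= (eta * mu) ^+ 2.
  by rewrite {1}/mu [m * p]mulrC.
have hmu0 : 0 <= eta * mu by rewrite mulr_ge0 // ltW.
have sqr_small (y : R) : y ^+ 2 <= (eta * mu) ^+ 2 -> `|y| <= eta * mu.
  by rewrite -[y ^+ 2]real_normK ?num_real // ler_sqr ?nnegrE.
have := sqr_ge0 (M - mu); have := sqr_ge0 (I - p * i) => I2 M2.
have /sqr_small : (M - mu) ^+ 2 <= (eta * mu) ^+ 2 by lra.
rewrite ler_norml => /andP[Ml Mu].
have /sqr_small : (I - p * i) ^+ 2 <= (eta * mu) ^+ 2 by lra.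
rewrite ler_norml => /andP[Il _].
have Ssmall : S <= (eta * mu) ^+ 2 by lra.
(* The subgraph has an edge, so its score is not the value set by convention. *)
have M0 : 0 < M.
  have : 0 < (1 - eta) * mu by rewrite mulr_gt0 //; lra.
  by lra.
set V := \sum_(A in P) ((vol G A)%:R : R) ^+ 2.
set VH := \sum_(A in P) ((vol H A)%:R : R) ^+ 2.
have VHu : VH <= (1 + eta) * (p ^+ 2 * V) + (1 + eta^-1) * S.
  rewrite /VH /V /S !mulr_sumr -big_split /=; apply: ler_sum => A _.
  by rewrite -exprMn; exact: young_sqr.
have scoreE (K : sgraph T) : 0 < ((nedges K)%:R : R) ->
    modularity_score R K P = (nedges K)%:R^-1 * edge_weight (inner_weight R P) K
      - (4 * (nedges K)%:R ^+ 2)^-1 * \sum_(A in P) (vol K A)%:R ^+ 2.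
  by rewrite ltr0n /modularity_score edges_withinE => /gtn_eqF ->.
rewrite !scoreE // -/m -/M -/i -/I -/V -/VH.
have V0 : 0 <= V by apply: sumr_ge0 => A _; exact: sqr_ge0.
have m20 : 0 < 4 * m ^+ 2 by rewrite mulr_gt0 // exprn_gt0.
have /andP[i0 i1] := inner_edge_weight_itv R PP G.
have mE : m != 0 by rewrite gt_eqF.
apply: (ratio_perturbation h0 h4 mu0) => //.
- rewrite [_^-1 * _]mulrC ler_pdivrMr // mul1r i1 andbT.
  by rewrite divr_ge0 // ltW.
- rewrite [_^-1 * _]mulrC ler_pdivrMr // mul1r sum_vol_sqr_le // andbT.
  by rewrite divr_ge0 // ltW.
- by lra.
- by lra.
- have -> : (m^-1 * i - eta) * mu = p * i - eta * mu.
    by rewrite /mu; field.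
  by lra.
apply: le_trans VHu _.
have -> : ((1 + eta) * (4 * ((4 * m ^+ 2)^-1 * V)) + (eta + eta ^+ 2)) * mu ^+ 2
   = (1 + eta) * (p ^+ 2 * V) + (1 + eta^-1) * (eta * mu) ^+ 2.
  by rewrite /mu; field; rewrite mE gt_eqF.
rewrite lerD2l ler_wpM2l // addr_ge0 // invr_ge0 ltW //.
Qed.

Unset Implicit Arguments.

Theorem theorem1p1 (R : realType) (eps : R) (heps : 0 < eps) :
  exists c : R,
    forall (T : finType) (G : sgraph T) (p : R),
      0 < p -> p <= 1 -> c <= (nedges G)%:R * p ->
      1 - eps <=
        percolation_prob p G
          (fun H : sgraph T => modularity R G - eps < modularity R H).
Proof.
(* 9 eta < eps is needed at the end, and eta <= 1 / 4 for the perturbation. *)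
pose eta : R := Num.min (eps / 10) (1 / 4).
have h0 : 0 < eta by rewrite lt_min; apply/andP; split; lra.
have h4 : eta <= 1 / 4 by rewrite ge_min lexx orbT.
have heps' : eta <= eps / 10 by rewrite ge_min lexx.
(* mu >= 6 / (eps eta^2) says exactly that 6 mu <= eps (eta mu)^2. *)
exists (6 / (eps * eta ^+ 2)) => T G p p0 p1 cmu.
set mu := _ * p in cmu.
have eh0 : 0 < eps * eta ^+ 2 by rewrite mulr_gt0 // exprn_gt0.
have mu0 : 0 < mu by apply: lt_le_trans cmu; rewrite divr_gt0.
have [P PP ->] := modularity_attained R G.
apply: (@percolation_markov R T p G (ltW p0) p1 (deviation P p G) _
         ((eta * mu) ^+ 2)).
- by rewrite exprn_gt0 // mulr_gt0.
- exact: deviation_ge0.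
- apply: le_trans (deviation_mean PP G (ltW p0) p1) _; rewrite -/mu.
  have -> : eps * (eta * mu) ^+ 2 = mu * (eps * eta ^+ 2) * mu by ring.
  by rewrite ler_wpM2r ?(ltW mu0) // -ler_pdivrMr.
move=> H /(score_perturbation PP h0 h4 mu0) GH.
have := modularity_ge R H PP.
by lra.
Qed.
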